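(* Let $\alpha\in(0,1/2)$ and $\beta\in(0,1-2\alpha)$. There exists a constant $c>0$ that only depends on $\alpha,\beta$ and $\sigma$ such that if $\varepsilon\le c\,\varepsilon^\star$, where $\varepsilon^\star=\varepsilon^\star(\tau)=\sqrt{(1\vee\log\tau)/n}$, then the asymptotic minimax type II error is at least $\beta$: $$\liminf_{n\to\infty}\ \inf_{\psi\in\Psi_\alpha}\ \sup_{P\in\mathcal{P}_{1,r}(\varepsilon;\tau)}P(\psi=0)\ \ge\ \beta .$$
   Context: Setting: $\boldsymbol X_1,\dots,\boldsymbol X_{2n}$ are i.i.d. random vectors from a distribution $P$ on $\mathbb{R}^d$, $d\ge2$, with mean $\boldsymbol\mu=(\mu_1,\dots,\mu_d)^\top$; the dimension $d=d_n$ may vary with $n$. Write $[d]=\{1,\dots,d\}$, $a\vee b=\max(a,b)$ (so $1\vee\log 0=1$), $\boldsymbol e_k$ for the $k$-th standard basis vector, and $\Theta=\Theta(P)=\arg\min_{k\in[d]}\mu_k$ for the set of all minimizing indices. Fix $r\in[d]$; the testing problem is $H_0:r\in\Theta$ versus $H_1:r\notin\Theta$. A test $\psi$ is a function of $\boldsymbol X_1,\dots,\boldsymbol X_{2n}$ with values in $\{0,1\}$, rejecting $H_0$ when $\psi=1$. Null class and tests: $\mathcal{P}_{0,r}$ is the collection of null distributions satisfying $r\in\Theta$ and the moment condition $$\max_{k\in[d]\setminus\{r\}}\ \sup_{P\in\mathcal{P}_{0,r}}\mathbb{E}_P\left[\frac{W_k^2}{\mathbb{E}_P[W_k^2]}\min\left\{1,\frac{|W_k|}{n^{1/2}(\mathbb{E}_P[W_k^2])^{1/2}}\right\}\right]=o(1)\quad(n\to\infty),\qquad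 W_k=(\boldsymbol e_r-\boldsymbol e_k)^\top(\boldsymbol X-\boldsymbol\mu).$$ The set of all asymptotic level-$\alpha$ tests over $\mathcal{P}_{0,r}$ is $$\Psi_\alpha=\Psi(\alpha,r)=\Bigl\{\psi:\ \limsup_{n\to\infty}\sup_{P\in\mathcal{P}_{0,r}}P(\psi=1)\le\alpha\Bigr\}.$$ Alternative class: let $\mu_\star=\min_{k\in[d]}\mu_k$ and $\Theta_{-r}=\arg\min_{k\in[d]\setminus\{r\}}\mu_k$ (the set of all minimizers). With $C_n$ any positive sequence such that $C_n\to\infty$, the confusion set is $$\mathbb{C}_r=\Bigl\{k\in[d]\setminus(\{r\}\cup\Theta_{-r}):\ \tfrac{\mu_r-\mu_\star}{2}\le\mu_k-\mu_\star\le C_n\sqrt{\tfrac{\log d}{n}}\Bigr\}.$$ $\mathcal{P}$ is the collection of distributions on $\mathbb{R}^d$ that are sub-Gaussian with fixed variance proxy $\sigma^2$: for every unit vector $\boldsymbol v\in\mathbb{R}^d$ and all $\lambda\in\mathbb{R}$, $\mathbb{E}_P[\exp(\lambda\langle\boldsymbol v,\boldsymbol X-\boldsymbol\mu\rangle)]\le\exp(\lambda^2\sigma^2/2)$. For $\varepsilon>0$ and $\tau\in\{0,1,\dots,d-2\}$, $$\mathcal{P}_{1,r}(\varepsilon;\tau)=\{P\in\mathcal{P}:\ \mu_r-\mu_\star\ge\varepsilon\ \text{and}\ |\mathbb{C}_r|=\tau\}.$$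
   Formalization: Proved as inf over ψ∈Ψ_α of liminf_n sup_P P(ψ=0) ≥ β (with liminf outside, the inf is 0 for each n, as Ψ_α is defined asymptotically); since no largest null class satisfies the o(1) condition, Ψ_α requires level α over every collection of null laws satisfying it. *)

(* Defs.v *)
From HB Require Import structures.
From mathcomp Require Import all_boot all_order all_algebra.
From mathcomp Require Import all_classical all_reals all_analysis.

Set Implicit Arguments.
Unset Strict Implicit.
Unset Printing Implicit Defensive.

Import Order.TTheory GRing.Theory Num.Theory.
Import numFieldNormedType.Exports.

Local Open Scope classical_set_scope.
Local Open Scope ring_scope.

Section iid_sample.
Context {disp : measure_display} {T : measurableType disp} {R : realType}.

Definition tuple_cons (m : nat) (x : T * m.-tuple T) : m.+1.-tuple T :=
  [the m.+1.-tuple T of x.1 :: x.2].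

Lemma measurable_tuple_cons (m : nat) :
  measurable_fun [set: T * m.-tuple T] (@tuple_cons m).
Proof. by apply: measurable_cons. Qed.

HB.instance Definition _ (m : nat) :=
  isMeasurableFun.Build _ _ _ _ (@tuple_cons m) (@measurable_tuple_cons m).

(* The m-fold product measure of P, i.e. the joint law of m i.i.d. draws from
   P, on the product sigma-algebra of m.-tuple T. *)
Fixpoint iid_law (P : probability T R) (m : nat) : probability (m.-tuple T) R :=
  match m with
  | 0 => \d_([tuple] : 0.-tuple T)
  | m'.+1 => distribution (P \x iid_law P m')%E (@tuple_cons m')
  end.

End iid_sample.

(* R^d with its Borel sigma-algebra, generated by the coordinates. *)
Notation rvec R d := (d.-tuple (measurableTypeR R)).

Section population.
Context {R : realType} {d : nat}.
Implicit Types (P : probability (rvec R d) R) (r k : 'I_d).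

Definition coordinate k (x : rvec R d) : R := tnth x k.

Definition has_mean P : Prop :=
  forall k, P.-integrable [set: rvec R d] (EFin \o coordinate k).

Definition mean P k : R := fine ('E_P[coordinate k])%E.

(* The set Theta(P). *)
Definition best P : pred 'I_d :=
  [pred k | [forall j, mean P k <= mean P j]].

(* The set Theta_{-r}(P). *)
Definition best_but P r : pred 'I_d :=
  [pred k | (k != r) && [forall (j | j != r), mean P k <= mean P j]].

(* The default value mean P r belongs to the family, so that this is mu_star. *)
Definition min_mean P r : R := \big[Num.min/mean P r]_(k < d) mean P k.

Definition confusion_set (C : R) (n : nat) P r : pred 'I_d :=
  [pred k | [&& k != r, ~~ best_but P r k,
    (mean P r - min_mean P r) / 2 <= mean P k - min_mean P r &
    mean P k - min_mean P r <= C * Num.sqrt (ln d%:R / n%:R)]].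

(* W_k = (e_r - e_k)^T (x - mu). *)
Definition contrast P r k (x : rvec R d) : R :=
  (coordinate r x - mean P r) - (coordinate k x - mean P k).

Definition contrast_var P r k : \bar R :=
  ('E_P[fun x => (contrast P r k x ^+ 2)%R])%E.

Definition truncated_moment (n : nat) P r k : \bar R :=
  let v := fine (contrast_var P r k) in
  ('E_P[fun x => (contrast P r k x ^+ 2 / v *
     Num.min 1 (`|contrast P r k x| / (Num.sqrt n%:R * Num.sqrt v)))%R])%E.

(* r is a best index; the variances of the contrasts are required to be positive
   and finite, as the normalized moments are undefined otherwise. *)
Definition null_distribution r P : Prop :=
  [/\ has_mean P,
      (forall k, k != r -> (0 < contrast_var P r k < +oo)%E) &
      best P r].

Definition sub_gaussian (sigma : R) P : Prop :=
  has_mean P /\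
  forall (v : 'I_d -> R) (lambda : R), \sum_(k < d) v k ^+ 2 = 1 ->
    ('E_P[fun x =>
         expR (lambda * \sum_(k < d) v k * (coordinate k x - mean P k))%R]
     <= (expR (lambda ^+ 2 * sigma ^+ 2 / 2))%:E)%E.

Definition alternative_class (sigma C : R) (n : nat) r (eps : R) (tau : nat) :
    set (probability (rvec R d) R) :=
  [set P | [/\ sub_gaussian sigma P,
      eps <= mean P r - min_mean P r &
      #|confusion_set C n P r| = tau]].

End population.

Section tests.
Context {R : realType}.
Variables (d : nat -> nat) (r : forall n, 'I_(d n)).

(* The n-th test is based on a sample of size 2n; true means rejection. *)
Definition test_sequence :=
  forall n, {mfun (2 * n).-tuple (rvec R (d n)) >-> bool}.

(* The o(1) condition is a property of a sequence of classes, one for each n.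
   The base value 0 of the maximum only matters when the n-th class is empty,
   since the moments are nonnegative. *)
Definition null_collection
    (P0 : forall n, set (probability (rvec R (d n)) R)) : Prop :=
  (forall n, P0 n `<=` null_distribution (r n)) /\
  (\big[maxe/0%E]_(k < d n | k != r n)
     ereal_sup [set truncated_moment n P (r n) k | P in P0 n])
    @[n --> \oo] --> 0%E.

Definition type1_error (psi : test_sequence) (n : nat)
    (P : probability (rvec R (d n)) R) : \bar R :=
  iid_law P (2 * n) [set x | psi n x = true].

Definition type2_error (psi : test_sequence) (n : nat)
    (P : probability (rvec R (d n)) R) : \bar R :=
  iid_law P (2 * n) [set x | psi n x = false].

(* There is no largest collection satisfying the o(1) condition, hence the
   quantification over all of them. *)
Definition asymptotic_level (alpha : R) : set test_sequence :=
  [set psi | forall P0, null_collection P0 ->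
    (limn_esup (fun n => ereal_sup [set type1_error psi P | P in P0 n])
       <= alpha%:E)%E].

End tests.

Definition critical_radius {R : realType} (n tau : nat) : R :=
  Num.sqrt (Num.max 1 (ln tau%:R) / n%:R).

(* Main.v *)
(* Two-point and three-point noise replaces Gaussian noise, so that all laws are
   finitely supported. Under the null law the coordinates are independent and
   centered, apart from a constant high mean at the irrelevant coordinates: the
   coordinate [r] is a fair sign scaled by [sigma / 4], and the coordinates of a
   set [S] of [tau + 1] indices take the values [-a], [0], [a] with probabilities
   [q], [1 - 2 q], [q], where [a = max eps (sigma / 4)]. The alternative [j \in S]
   replaces the law of coordinate [j] with its mixture with the point mass at
   [-a], which lowers its mean by [eps]; the remaining [tau] indices of [S] are
   then the confusion set. Letting [q] decrease like [expR (- (a / sigma) ^+ 2)]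
   keeps all laws sub-Gaussian, even when [ln tau / n], hence [eps], is unbounded,
   while the second moment [B] of a likelihood ratio is at most [expR (K eps ^+ 2)].
   As the likelihood ratios of distinct alternatives are uncorrelated, the
   chi-square divergence of the average alternative over [2 n] draws is at most
   [(B ^+ (2 n) - 1) / (tau + 1)], which is small below the critical radius, so
   that no test separates the null law from every alternative. *)
Require Import Defs.
From mathcomp Require Import all_boot all_order all_algebra.
From mathcomp Require Import all_classical all_reals all_analysis.
From mathcomp Require Import measurable_realfun.
From mathcomp Require Import ring lra.
Set Implicit Arguments.
Unset Strict Implicit.
Unset Printing Implicit Defensive.
Import Order.TTheory GRing.Theory Num.Theory.
Import numFieldNormedType.Exports.
Local Open Scope classical_set_scope.
Local Open Scope ring_scope.

(** * Laws with finite support, given by weights and points *)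

Section finite_law.
Context {disp : measure_display} {T : measurableType disp} {R : realType}.
Context {Omega : finType}.
Implicit Types (p : Omega -> R) (x : Omega -> T) (P : probability T R).

(** Stated through integrals of nonnegative functions, rather than as an equality of measures, so
    that expectations and the iterated integrals of product measures become finite sums at once. *)
Definition finite_law p x P : Prop :=
  forall f : T -> \bar R, measurable_fun [set: T] f -> (forall y, 0 <= f y)%E ->
    (\int[P]_y f y = \sum_(w : Omega) (p w)%:E * f (x w))%E.

Lemma finite_measure_exists p x (s : seq Omega) : (forall w, 0 <= p w) ->
  exists m : {measure set T -> \bar R},
    forall f : T -> \bar R, measurable_fun [set: T] f ->
      (forall y, 0 <= f y)%E ->
      (\int[m]_y f y = \sum_(w <- s) (p w)%:E * f (x w))%E.
Proof.
move=> p0; elim: s => [|w s [m mE]].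
  by exists mzero => f mf f0; rewrite big_nil integral_measure_zero.
exists (measure_add (mscale (NngNum (p0 w)) (dirac (x w))) m) => f mf f0.
rewrite ge0_integral_measure_add// big_cons mE//.
by rewrite ge0_integral_mscale//= integral_dirac// diracT mul1e.
Qed.

Lemma finite_law_exists p x : (forall w, 0 <= p w) -> \sum_w p w = 1 ->
  exists P, finite_law p x P.
Proof.
move=> p0 p1.
have [m mE] := finite_measure_exists x (index_enum Omega) p0.
have m1 : m [set: T] = 1%E.
  rewrite -(setIT [set: T]) -integral_indic// mE//.
  - under eq_bigr do rewrite indicT mule1.
    by rewrite sumEFin p1.
  - exact/measurable_EFinP/measurable_indic.
(* Normalization takes a fallback probability, here a Dirac mass, so [Omega] must have a point;
   weights of total 1 provide one. As [m] has mass 1, normalization leaves it unchanged. *)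
have [w _ _] : exists2 w, w \in Omega & p w != 0.
  apply/exists_inP; apply: contraT => /exists_inPn p_eq0.
  rewrite -(oner_eq0 R) -p1 big1// => w _; apply/eqP/negbNE.
  exact: p_eq0.
exists (mnormalize m (dirac (x w)) : probability T R) => f mf f0; rewrite -mE//.
apply: eq_measure_integral => A mA _ /=.
by rewrite /mnormalize m1 onee_eq0/= invr1 mule1.
Qed.

Lemma finite_law_integrable p x P (f : T -> R) : finite_law p x P ->
  measurable_fun [set: T] f -> P.-integrable [set: T] (EFin \o f).
Proof.
move=> Px mf; apply/integrableP; split; first exact/measurable_EFinP.
rewrite Px//.
- under eq_bigr do rewrite /= -EFinM.
  by rewrite sumEFin ltry.
- by apply: measurableT_comp => //; exact/measurable_EFinP.
Qed.

Lemma finite_law_expectation p x P (f : T -> R) : finite_law p x P ->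
  measurable_fun [set: T] f ->
  ('E_P[f] = (\sum_w p w * f (x w))%:E)%E.
Proof.
move=> Px mf; rewrite unlock integralE !Px//.
- under eq_bigr do rewrite funeposE -EFin_max -EFinM.
  under [X in (_ - X)%E]eq_bigr do rewrite funenegE -EFin_max -EFinM.
  rewrite !sumEFin -EFinD -sumrB; congr (_%:E); apply: eq_bigr => w _.
  rewrite -mulrBr; congr (_ * _).
  by have /(congr1 (fun g : T -> R => g (x w))) := funrposBneg f.
- by apply: measurable_funeneg; exact/measurable_EFinP.
- by apply: measurable_funepos; exact/measurable_EFinP.
Qed.

End finite_law.

(** * Expectations over independent draws as finite sums *)

Section product_sums.
Context {R : realType} {Omega : finType}.
Implicit Types (p l : Omega -> R).

(** The recursion follows that of [iid_law], so that the two are matched by induction on [m]. *)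
Fixpoint iid_sum p m : (m.-tuple Omega -> R) -> R :=
  match m with
  | 0 => fun phi => phi [tuple]
  | m'.+1 => fun phi =>
      \sum_w p w * iid_sum p (fun z : m'.-tuple Omega => phi [tuple of w :: z])
  end.

Lemma eq_iid_sum p m (f g : m.-tuple Omega -> R) :
  f =1 g -> iid_sum p f = iid_sum p g.
Proof. by move=> fg; congr iid_sum; exact/funext. Qed.

Lemma iid_sumD p m (f g : m.-tuple Omega -> R) :
  iid_sum p (fun z => f z + g z) = iid_sum p f + iid_sum p g.
Proof.
elim: m f g => [//|m IH] f g /=; rewrite -big_split/=.
by apply: eq_bigr => w _; rewrite IH mulrDr.
Qed.

Lemma iid_sumZ p m (a : R) (f : m.-tuple Omega -> R) :
  iid_sum p (fun z => a * f z) = a * iid_sum p f.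
Proof.
elim: m f => [//|m IH] f /=; rewrite big_distrr/=.
by apply: eq_bigr => w _; rewrite IH mulrCA.
Qed.

Lemma iid_sum_sum p m (I : Type) (s : seq I) (P : pred I)
    (f : I -> m.-tuple Omega -> R) :
  iid_sum p (fun z => \sum_(i <- s | P i) f i z) =
  \sum_(i <- s | P i) iid_sum p (f i).
Proof.
elim: s => [|i s IH].
  under eq_iid_sum do rewrite big_nil -(mul0r 0).
  by rewrite iid_sumZ mul0r big_nil.
rewrite big_cons -IH; case: ifP => Pi.
  rewrite -iid_sumD; apply: eq_iid_sum => z.
  by rewrite big_cons Pi.
by apply: eq_iid_sum => z; rewrite big_cons Pi.
Qed.

Lemma le_iid_sum p m (f g : m.-tuple Omega -> R) : (forall w, 0 <= p w) ->
  (forall z, f z <= g z) -> iid_sum p f <= iid_sum p g.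
Proof.
move=> p0; elim: m f g => [|m IH] f g fg /=; first exact: fg.
by apply: ler_sum => w _; rewrite ler_wpM2l// IH.
Qed.

Lemma iid_sum_prod p l m :
  iid_sum p (fun z : m.-tuple Omega => \prod_(w <- z) l w) =
  (\sum_w p w * l w) ^+ m.
Proof.
elim: m => [|m IH] /=; first by rewrite big_nil.
rewrite exprS -IH big_distrl/=; apply: eq_bigr => w _.
rewrite -mulrA; congr (_ * _); rewrite -iid_sumZ.
by apply: eq_iid_sum => z; rewrite big_cons.
Qed.

(** Change of measure: the likelihood ratio of a sample is the product of the ratios of its
    draws. *)
Lemma iid_sum_tilt p l m (f : m.-tuple Omega -> R) :
  iid_sum (fun w => p w * l w) f =
  iid_sum p (fun z => \prod_(w <- z) l w * f z).
Proof.
elim: m f => [|m IH] f /=; first by rewrite big_nil mul1r.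
apply: eq_bigr => w _; rewrite -mulrA IH -iid_sumZ; congr (_ * _).
by apply: eq_iid_sum => z; rewrite big_cons mulrA.
Qed.

End product_sums.

Lemma iid_law_finite (disp : measure_display) (T : measurableType disp)
    (R : realType) (Omega : finType) (p : Omega -> R) (x : Omega -> T)
    (P : probability T R) m (A : set (m.-tuple T)) :
  finite_law p x P -> measurable A ->
  iid_law P m A = (iid_sum p (fun z => \1_A (map_tuple x z)))%:E.
Proof.
move=> Px; elim: m A => [|m IH] A mA /=.
  rewrite /dirac/=; congr ((\1_A _)%:E); exact/val_inj.
(* The product measure integrates the measures of the sections of the preimage of [A], to which the
   induction hypothesis applies. *)
rewrite /pushforward/= /product_measure1 Px//=.
- rewrite -sumEFin; apply: eq_bigr => w _.
  rewrite EFinM; congr (_ * _)%E; rewrite IH.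
    congr (_%:E); apply: eq_iid_sum => z.
    have -> : map_tuple x [tuple of w :: z] = tuple_cons (x w, map_tuple x z).
      exact/val_inj.
    by rewrite !indicE mem_xsection; congr ((nat_of_bool _)%:R).
  apply: measurable_xsection.
  by rewrite -[X in measurable X]setTI; exact: measurable_tuple_cons.
- apply: measurable_fun_xsection.
  by rewrite -[X in measurable X]setTI; exact: measurable_tuple_cons.
Qed.

(* Averages over [S] of the laws with likelihood ratios [l j] are compared with
   the base law through the second moment of the average likelihood ratio; the
   Cauchy-Schwarz inequality is replaced with the pointwise bound
   [u <= (u ^+ 2 / delta + delta) / 2]. *)
Lemma mixture_bound (R : realType) (Omega I : finType) (p : Omega -> R)
    (S : {set I}) (l : I -> Omega -> R) (B delta : R) m
    (phi : m.-tuple Omega -> R) :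
  (forall w, 0 <= p w) -> \sum_w p w = 1 -> 0 < delta -> (0 < #|S|)%N ->
  (forall z, 0 <= phi z <= 1) ->
  (forall j, j \in S -> \sum_w p w * l j w = 1) ->
  (forall j, j \in S -> \sum_w p w * (l j w * l j w) <= B) ->
  (forall j k, j \in S -> k \in S -> j != k ->
    \sum_w p w * (l j w * l k w) = 1) ->
  B ^+ m - 1 <= delta ^+ 2 * #|S|%:R ->
  \sum_(j in S) iid_sum (fun w => p w * l j w) phi <=
    #|S|%:R * (iid_sum p phi + delta).
Proof.
move=> p0 p1 d0 S0 phi01 l1 l2 l12 BS.
set N : R := #|S|%:R.
have N0 : 0 < N by rewrite ltr0n.
under eq_bigr do rewrite iid_sum_tilt.
rewrite -iid_sum_sum.
pose L (z : m.-tuple Omega) : R := \sum_(j in S) \prod_(w <- z) l j w.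
rewrite (@eq_iid_sum _ _ _ _ _ (fun z => L z * phi z)); last first.
  by move=> z; rewrite /L big_distrl.
have E1 : iid_sum p (fun _ : m.-tuple Omega => 1) = 1.
  transitivity ((\sum_w p w * 1) ^+ m).
    by rewrite -iid_sum_prod; apply: eq_iid_sum => z; rewrite big1.
  by rewrite -big_distrl/= p1 mulr1 expr1n.
have EL : iid_sum p L = N.
  rewrite iid_sum_sum (eq_bigr (fun=> 1)); first by rewrite sumr_const.
  by move=> j jS; rewrite iid_sum_prod l1// expr1n.
(* In the expanded square each of the [N * (N - 1)] pairs of distinct indices contributes 1, and
   each diagonal term at most [B ^+ m]. *)
have ELL : iid_sum p (fun z => L z * L z) <= N ^+ 2 + N * (B ^+ m - 1).
  under eq_iid_sum do rewrite big_distrl/=.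
  rewrite iid_sum_sum.
  apply: (@le_trans _ _ (\sum_(j in S) (N + (B ^+ m - 1)))); last first.
    by rewrite sumr_const -mulr_natl -/N mulrDr expr2.
  apply: ler_sum => j jS.
  under eq_iid_sum do rewrite big_distrr/=.
  rewrite iid_sum_sum (bigD1 j)//=.
  rewrite (eq_bigr (fun=> 1)); last first.
    move=> k /andP[kS kj]; under eq_iid_sum do rewrite -big_split/=.
    by rewrite iid_sum_prod l12 ?expr1n// eq_sym.
  under eq_iid_sum do rewrite -big_split/=.
  rewrite iid_sum_prod.
  have -> : \sum_(i in S | i != j) (1 : R) = N - 1.
    rewrite /N -[in RHS]sum1_card natr_sum (bigD1 j jS)/= addrAC subrr add0r.
    by apply: eq_bigr.
  suff : (\sum_w p w * (l j w * l j w)) ^+ m <= B ^+ m by lra.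
  rewrite lerXn2r ?nnegrE ?l2//.
    apply: sumr_ge0 => w _; rewrite mulr_ge0// -expr2; exact: sqr_ge0.
  apply: le_trans (l2 _ jS); apply: sumr_ge0 => w _.
  by rewrite mulr_ge0// -expr2; exact: sqr_ge0.
(* With this [a], the bound [u <= a * u ^+ 2 + delta * N / 2] is tight at [u = delta * N]. *)
pose a := (2 * delta * N)^-1.
have a0 : 0 < a by rewrite invr_gt0 !mulr_gt0.
have aE : 2 * delta * N * a = 1 by rewrite /a divff// gt_eqF// !mulr_gt0.
(* The bound at [u = L z - N], expanded so that linearity of [iid_sum] applies. If [L z <= N], the
   product [u * phi z] is nonpositive; otherwise [phi z <= 1] is used. *)
have pw z : L z * phi z <= N * phi z + (a * (L z * L z) +
   ((- 2 * a * N) * L z + (a * N ^+ 2 + delta * N / 2) * 1)).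
  have /andP[f0 f1] := phi01 z.
  have H : L z - N <= a * (L z - N) ^+ 2 + delta * N / 2.
    have := sqr_ge0 (L z - N - delta * N) => /(ler_wpM2l (ltW a0)).
    have -> : a * (L z - N - delta * N) ^+ 2 = a * (L z - N) ^+ 2 -
      (2 * delta * N * a) * (L z - N) + (2 * delta * N * a) * (delta * N / 2).
      by field.
    by rewrite aE; lra.
  have H2 : 0 <= a * (L z - N) ^+ 2 + delta * N / 2.
    have := mulr_ge0 (ltW a0) (sqr_ge0 (L z - N)).
    by have := mulr_gt0 d0 N0; lra.
  have : (L z - N) * phi z <= a * (L z - N) ^+ 2 + delta * N / 2.
    have [LN|LN] := leP (L z) N.
      by apply: le_trans H2; rewrite mulr_le0_ge0// subr_le0.
    apply: le_trans H; rewrite -[leRHS]mulr1 ler_wpM2l// subr_ge0 ltW//.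
  by rewrite /=; lra.
apply: le_trans (le_iid_sum p0 pw) _.
rewrite iid_sumD iid_sumD iid_sumD !iid_sumZ EL E1.
have := ler_wpM2l (ltW a0) ELL.
have : a * (N * (B ^+ m - 1)) <= delta * N / 2.
  have := ler_wpM2l (ltW (mulr_gt0 a0 N0)) BS; rewrite -/N.
  have -> : a * N * (delta ^+ 2 * N) = (2 * delta * N * a) * (delta * N / 2).
    by field.
  by rewrite aE; lra.
lra.
Qed.

(** * Independent coordinates with values in a finite type *)

Section product_weights.
Context {R : realType} {I V : finType}.
Implicit Types (p g : I -> V -> R).

Definition prod_weight p (w : {ffun I -> V}) : R := \prod_k p k (w k).

Lemma prod_weight_ge0 p w : (forall k v, 0 <= p k v) -> 0 <= prod_weight p w.
Proof. by move=> p0; apply: prodr_ge0. Qed.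

Lemma sum_prod_weight p g :
  \sum_w prod_weight p w * \prod_k g k (w k) = \prod_k \sum_v p k v * g k v.
Proof.
rewrite bigA_distr_bigA/=; apply: eq_bigr => w _.
by rewrite /prod_weight -big_split.
Qed.

Lemma sum_prod_weight1 p :
  (forall k, \sum_v p k v = 1) -> \sum_w prod_weight p w = 1.
Proof.
by move=> p1; rewrite /prod_weight -bigA_distr_bigA big1.
Qed.

Lemma prod_weight_marginal p j (g : V -> R) : (forall k, \sum_v p k v = 1) ->
  \sum_w prod_weight p w * g (w j) = \sum_v p j v * g v.
Proof.
move=> p1; pose G k v : R := if k == j then g v else 1.
transitivity (\sum_w prod_weight p w * \prod_k G k (w k)).
  apply: eq_bigr => w _; rewrite (bigD1 j)//= /G eqxx big1 ?mulr1//.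
  by move=> k /negbTE ->.
rewrite sum_prod_weight (bigD1 j)//= /G eqxx.
rewrite [X in _ * X]big1 ?mulr1// => k /negbTE ->.
by rewrite -[RHS](p1 k); apply: eq_bigr => v _; rewrite mulr1.
Qed.

(** Independence of two coordinates. Applied to likelihood ratios, it makes distinct alternatives
    uncorrelated; applied to signs, it removes the cross term from the variance of a contrast. *)
Lemma prod_weight_marginal2 p i j (g h : V -> R) :
  (forall k, \sum_v p k v = 1) -> i != j ->
  \sum_w prod_weight p w * (g (w i) * h (w j)) =
  (\sum_v p i v * g v) * (\sum_v p j v * h v).
Proof.
move=> p1 ij; have ji : j != i by rewrite eq_sym.
pose G k v : R := if k == i then g v else if k == j then h v else 1.
transitivity (\sum_w prod_weight p w * \prod_k G k (w k)).
  apply: eq_bigr => w _; rewrite (bigD1 i)//= (bigD1 j)//= /G !eqxx (negbTE ji).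
  by rewrite big1 ?mulr1// => k /andP[/negbTE -> /negbTE ->].
rewrite sum_prod_weight (bigD1 i)//= (bigD1 j)//= /G !eqxx (negbTE ji).
rewrite [X in _ * (_ * X)]big1 ?mulr1// => k /andP[/negbTE -> /negbTE ->].
by rewrite -[RHS](p1 k); apply: eq_bigr => v _; rewrite mulr1.
Qed.

Definition tilt_at (l : V -> R) p j k v : R :=
  if k == j then p k v * l v else p k v.

Lemma prod_weight_tilt_at l p j w :
  prod_weight (tilt_at l p j) w = prod_weight p w * l (w j).
Proof.
rewrite /prod_weight (bigD1 j)//= [in RHS](bigD1 j)//= /tilt_at eqxx.
rewrite mulrAC; congr (_ * _ * _); apply: eq_bigr => k /negbTE ->//.
Qed.

End product_weights.

(** * Moments and generating functions of three-point laws *)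

Section three_point.
Context {R : realType}.
Implicit Types (q t a y sigma eps u : R) (v : 'I_3).

(* The values -1, 0, 1 are encoded by the indices 0, 1, 2. *)
Definition sign3 v : R := v%:R - 1.

Definition three_point q v : R := if val v == 1%N then 1 - 2 * q else q.

(* Density, with respect to [three_point q], of the mixture giving weight
   [1 - t] to [three_point q] and [t] to the point mass at -1. *)
Definition tilt q t v : R := 1 - t + (if val v == 0%N then t / q else 0).

Lemma sum3 (F : 'I_3 -> R) :
  \sum_v F v = F ord0 + F (lift ord0 ord0) + F (lift ord0 (lift ord0 ord0)).
Proof. by rewrite !big_ord_recl big_ord0 addr0 addrA. Qed.

Lemma sign3E : (sign3 ord0 = -1) * (sign3 (lift ord0 ord0) = 0) *
  (sign3 (lift ord0 (lift ord0 ord0)) = 1).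
Proof. by split; [split|]; rewrite /sign3/= ?sub0r ?subrr// addrK. Qed.

Lemma three_point_ge0 q v : 0 <= q <= 1 / 2 -> 0 <= three_point q v.
Proof. by move=> q01; rewrite /three_point; case: ifP => _; lra. Qed.

Lemma tilt_ge0 q t v : 0 < q -> 0 <= t <= 1 -> 0 <= tilt q t v.
Proof.
move=> q0 t01; rewrite /tilt; case: ifP => _; last by lra.
have : 0 <= t / q by case/andP: t01 => t0 _; rewrite divr_ge0// ltW.
lra.
Qed.

Lemma three_point_sum q : \sum_v three_point q v = 1.
Proof. by rewrite sum3 /three_point/=; lra. Qed.

Lemma three_point_mean q : \sum_v three_point q v * sign3 v = 0.
Proof. by rewrite sum3 !sign3E /three_point/=; lra. Qed.

Lemma three_point_tilt_sum q t : q != 0 ->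
  \sum_v three_point q v * tilt q t v = 1.
Proof. by move=> q0; rewrite sum3 /three_point /tilt/=; field. Qed.

Lemma three_point_tilt_mean q t : q != 0 ->
  \sum_v three_point q v * tilt q t v * sign3 v = - t.
Proof. by move=> q0; rewrite sum3 !sign3E /three_point /tilt/=; field. Qed.

(** One plus the chi-square divergence of the mixture, which is [t ^+ 2] times the divergence
    [q^-1 - 1] of the point mass. *)
Lemma three_point_tilt_sqr q t : q != 0 ->
  \sum_v three_point q v * (tilt q t v * tilt q t v) = 1 + t ^+ 2 * (q^-1 - 1).
Proof. by move=> q0; rewrite sum3 /three_point /tilt/=; field. Qed.

(** Both sides are even in [u]. For [u >= 0], [expR (- u) = expR (- (2 * u)) * expR u >= (1 - 2 * u)
    * expR u]. *)
Lemma sqr_expR_diff_le u :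
  (expR u - expR (- u)) ^+ 2 <= 4 * u ^+ 2 * expR (2 * `|u|).
Proof.
wlog u0 : u / 0 <= u.
  move=> H; have [/H//|u0] := leP 0 u.
  have := H (- u); rewrite opprK normrN sqrrN oppr_ge0 => /(_ (ltW u0)).
  by rewrite -(sqrrN (expR (- u) - _)) opprB.
rewrite ger0_norm// expRM_natl.
have H : 0 <= expR u - expR (- u) <= 2 * u * expR u.
  have : expR (- u) <= expR u by rewrite ler_expR; lra.
  have := ler_wpM2r (expR_ge0 u) (expR_ge1Dx (- (2 * u))).
  rewrite -expRD (_ : - (2 * u) + u = - u); last by ring.
  lra.
have -> : 4 * u ^+ 2 * expR u ^+ 2 = (2 * u * expR u) ^+ 2 by ring.
by rewrite lerXn2r ?nnegrE//; lra.
Qed.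

(** The left side is the square of [expR (u / 2) - expR (- (u / 2))]. *)
Lemma cosh_sub1_ub u :
  expR u + expR (- u) - 2 <= u ^+ 2 * expR `|u|.
Proof.
have := sqr_expR_diff_le (u / 2).
rewrite normrM (ger0_norm (_ : 0 <= 2^-1 :> R)) ?invr_ge0//.
rewrite (_ : 2 * (`|u| / 2) = `|u|); last by field.
have -> : (expR (u / 2) - expR (- (u / 2))) ^+ 2 =
   expR (u / 2) ^+ 2 + expR (- (u / 2)) ^+ 2 -
     2 * (expR (u / 2) * expR (- (u / 2))) by ring.
rewrite -!expRM_natl -expRD subrr expR0.
rewrite (_ : 2 * (u / 2) = u); last by field.
rewrite (_ : 2 * - (u / 2) = - u); last by field.
by rewrite (_ : 4 * (u / 2) ^+ 2 = u ^+ 2); [lra|field].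
Qed.

Lemma three_point_mgf q a y sigma : 0 < sigma -> 0 <= q ->
  q * a ^+ 2 * expR (a ^+ 2 / sigma ^+ 2) <= sigma ^+ 2 / 4 ->
  \sum_v three_point q v * expR (y * (a * sign3 v)) <=
  expR (y ^+ 2 * sigma ^+ 2 / 2).
Proof.
move=> s0 q0 qa; rewrite sum3 !sign3E /three_point/=.
rewrite !mulr0 expR0 !mulr1 mulrN1 mulrN.
set u := y * a; set E := expR (y ^+ 2 * sigma ^+ 2 / 4).
(* Arithmetic-geometric mean inequality for [|a| / sigma] and [|y| * sigma / 2]: it separates the
   factor in [a], which [q] compensates, from the factor in [y]. *)
have uE : expR `|u| <= expR (a ^+ 2 / sigma ^+ 2) * E.
  rewrite -expRD ler_expR.
  have := sqr_ge0 (`|a| / sigma - `|y| * sigma / 2).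
  have -> : (`|a| / sigma - `|y| * sigma / 2) ^+ 2 =
    `|a| ^+ 2 / sigma ^+ 2 - `|y| * `|a| + `|y| ^+ 2 * sigma ^+ 2 / 4.
    by field; rewrite gt_eqF.
  by rewrite !real_normK ?num_real// -normrM -/u; lra.
have H1 := ler_wpM2l q0 (cosh_sub1_ub u).
have H2 : q * (u ^+ 2 * expR `|u|) <= y ^+ 2 * (sigma ^+ 2 / 4) * E.
  apply: (@le_trans _ _ (y ^+ 2 * (q * a ^+ 2 *
     expR (a ^+ 2 / sigma ^+ 2)) * E)); last first.
    by rewrite ler_wpM2r ?expR_ge0// ler_wpM2l// sqr_ge0.
  have -> : q * (u ^+ 2 * expR `|u|) = q * u ^+ 2 * expR `|u| by ring.
  have -> : y ^+ 2 * (q * a ^+ 2 * expR (a ^+ 2 / sigma ^+ 2)) * E =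
    q * u ^+ 2 * (expR (a ^+ 2 / sigma ^+ 2) * E) by rewrite /u; ring.
  by rewrite ler_wpM2l// mulr_ge0// sqr_ge0.
have E1 : 1 <= E.
  rewrite -expR0 ler_expR; have := mulr_ge0 (sqr_ge0 y) (sqr_ge0 sigma).
  lra.
have H3 : (1 + y ^+ 2 * sigma ^+ 2 / 4) * E <= expR (y ^+ 2 * sigma ^+ 2 / 2).
  have -> : expR (y ^+ 2 * sigma ^+ 2 / 2) = E * E.
    by rewrite /E -expRD; congr expR; field.
  by rewrite ler_wpM2r ?expR_ge0 ?expR_ge1Dx.
by lra.
Qed.

Lemma expR_small_le u : 0 <= u <= 1 / 4 -> expR u <= 2.
Proof.
move=> u14; have := expR_ge1Dx (- u).
have H := expRN u; have := expR_gt0 u.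
have := expRxMexpNx_1 u; nra.
Qed.

(** The constant 2 is not sharp, but follows from [cosh_sub1_ub] and [|u| <= u ^+ 2 + 1 / 4]. *)
Lemma cosh_le_expR u : (expR u + expR (- u)) / 2 <= expR (2 * u ^+ 2).
Proof.
have H := cosh_sub1_ub u.
have H1 : expR `|u| <= 2 * expR (u ^+ 2).
  apply: (@le_trans _ _ (expR (1 / 4 + u ^+ 2))).
    rewrite ler_expR -(real_normK (num_real u)).
    have := sqr_ge0 (`|u| - 1 / 2); nra.
  by rewrite expRD ler_wpM2r ?expR_ge0// expR_small_le; lra.
have H2 := ler_wpM2l (sqr_ge0 u) H1.
have H3 : (1 + u ^+ 2) * expR (u ^+ 2) <= expR (2 * u ^+ 2).
  rewrite (_ : 2 * u ^+ 2 = u ^+ 2 + u ^+ 2); last by ring.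
  by rewrite expRD ler_wpM2r ?expR_ge0 ?expR_ge1Dx.
have : 1 <= expR (u ^+ 2) by rewrite -expR0 ler_expR sqr_ge0.
lra.
Qed.

(* Jensen's inequality [expR (- y m) <= E expR (- y X)] reduces the centered
   moment generating function to a product of two noncentered ones. *)
Lemma bounded_mgf (p : 'I_3 -> R) s y :
  (forall v, 0 <= p v) -> \sum_v p v = 1 ->
  \sum_v p v * expR (y * (s * sign3 v - s * \sum_u p u * sign3 u)) <=
  expR (4 * (y * s) ^+ 2).
Proof.
move=> p0 p1; set m := \sum_u p u * sign3 u.
have jensen : expR (- (y * s * m)) <= \sum_v p v * expR (- (y * s * sign3 v)).
  (* The tangent of the exponential at the mean lies below its graph. *)
  apply: (@le_trans _ _ (\sum_v p v *
     (expR (- (y * s * m)) * (1 - y * s * (sign3 v - m))))); last first.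
    apply: ler_sum => v _; rewrite ler_wpM2l//.
    have -> : expR (- (y * s * sign3 v)) =
       expR (- (y * s * m)) * expR (- (y * s * (sign3 v - m))).
      by rewrite -expRD; congr expR; ring.
    by rewrite ler_wpM2l ?expR_ge0 ?expR_ge1Dx.
  have -> : \sum_v p v * (expR (- (y * s * m)) * (1 - y * s * (sign3 v - m))) =
    expR (- (y * s * m)) * ((1 + y * s * m) * (\sum_v p v)
       - y * s * \sum_v p v * sign3 v).
    set E := expR _.
    rewrite (eq_bigr (fun v => E * (1 + y * s * m) * p v -
        E * y * s * (p v * sign3 v))); last by move=> v _; ring.
    by rewrite sumrB -!mulr_sumr; ring.
  by rewrite p1 -/m; lra.
clearbody m; have -> : \sum_v p v * expR (y * (s * sign3 v - s * m)) =
   expR (- (y * s * m)) * \sum_v p v * expR (y * s * sign3 v).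
  rewrite mulr_sumr; apply: eq_bigr => v _.
  by rewrite mulrCA -expRD; congr (_ * expR _); ring.
have A0 : 0 <= \sum_v p v * expR (y * s * sign3 v).
  by apply: sumr_ge0 => v _; rewrite mulr_ge0 ?expR_ge0.
apply: le_trans (ler_wpM2r A0 jensen) _.
move: p1 A0; rewrite !sum3 !sign3E !mulr0 oppr0 expR0 !mulr1 !mulrN1 opprK.
set u := y * s.
have xzE := cosh_le_expR u; have x0 := expR_gt0 u; have z0 := expR_gt0 (- u).
have ch1 : 1 <= (expR u + expR (- u)) / 2.
  by have := expR_ge1Dx u; have := expR_ge1Dx (- u); lra.
have -> : expR (4 * u ^+ 2) = expR (2 * u ^+ 2) ^+ 2.
  by rewrite -expRM_natl; congr expR; ring.
have c0 := p0 ord0; have b0 := p0 (lift ord0 ord0).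
have a0 := p0 (lift ord0 (lift ord0 ord0)).
set c := p ord0 in c0 *; set b := p (lift ord0 ord0) in b0 *.
set a := p (lift ord0 (lift ord0 ord0)) in a0 *.
set x := expR u in xzE x0 ch1 *; set z := expR (- u) in xzE z0 ch1 *.
set E := expR _ in xzE *.
clearbody a b c x z E => abc A0.
have cE : c = 1 - b - a by lra.
set ch := (x + z) / 2 in ch1 xzE.
(* Replacing the weight [b] of the value 0 by [b * ch] bounds the two generating functions by [ch]
   plus and minus the same quantity, so their product is at most [ch ^+ 2]. *)
have h1 : b <= b * ch by nra.
have h2 : c * x + b + a * z <= ch + (a - c) * (z - x) / 2.
  by rewrite cE /ch; rewrite /ch in h1; lra.
have h3 : c * z + b + a * x <= ch - (a - c) * (z - x) / 2.
  by rewrite cE /ch; rewrite /ch in h1; lra.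
apply: (@le_trans _ _ (ch ^+ 2)); last first.
  by rewrite lerXn2r// ?nnegrE; lra.
apply: (@le_trans _ _ ((ch + (a - c) * (z - x) / 2) *
   (ch - (a - c) * (z - x) / 2))).
  apply: ler_pM => //; have := mulr_ge0 c0 (ltW x0).
  by have := mulr_ge0 a0 (ltW z0); lra.
have := sqr_ge0 ((a - c) * (z - x) / 2); lra.
Qed.

End three_point.

(** * Calibration of the noise on [S] *)

Section noise.
Context {R : realType}.
Implicit Types (sigma eps : R).

(* The scale is constant for small [eps]; for large [eps] it has to grow, and
   the probability of the extreme values then decreases like a Gaussian tail,
   so that the noise remains sub-Gaussian. *)
Definition noise_scale sigma eps : R := Num.max eps (sigma / 4).

(** Chosen so that [q * a ^+ 2 * expR (a ^+ 2 / sigma ^+ 2)] equals [sigma ^+ 2 / 32], within the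
    bound [sigma ^+ 2 / 4] of [three_point_mgf]. *)
Definition noise_prob sigma eps : R :=
  let a := noise_scale sigma eps in
  (sigma / 4) ^+ 2 / (2 * a ^+ 2) * expR (- (a ^+ 2 / sigma ^+ 2)).

Lemma noise_scale_ge sigma eps : sigma / 4 <= noise_scale sigma eps.
Proof. by rewrite le_max lexx orbT. Qed.

Lemma noise_scale_ge_eps sigma eps : eps <= noise_scale sigma eps.
Proof. by rewrite le_max lexx. Qed.

Lemma noise_scale_gt0 sigma eps : 0 < sigma -> 0 < noise_scale sigma eps.
Proof. by move=> s0; apply: lt_le_trans (noise_scale_ge _ _); lra. Qed.

Lemma noise_prob_gt0 sigma eps : 0 < sigma -> 0 < noise_prob sigma eps.
Proof.
move=> s0; rewrite /noise_prob mulr_gt0 ?expR_gt0// divr_gt0//.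
  by rewrite exprn_gt0//; lra.
by rewrite mulr_gt0// exprn_gt0// noise_scale_gt0.
Qed.

Lemma noise_prob_le sigma eps : 0 < sigma -> noise_prob sigma eps <= 1 / 2.
Proof.
move=> s0; rewrite /noise_prob.
have a0 := noise_scale_gt0 eps s0; have sa := noise_scale_ge sigma eps.
set a := noise_scale sigma eps in a0 sa *.
rewrite -[leRHS]mulr1; apply: ler_pM; rewrite ?expR_ge0//.
- by rewrite divr_ge0 ?sqr_ge0// mulr_ge0// sqr_ge0.
- rewrite ler_pdivrMr ?mulr_gt0 ?exprn_gt0//.
  have : (sigma / 4) ^+ 2 <= a ^+ 2 by rewrite lerXn2r// nnegrE; lra.
  lra.
- by rewrite expR_le1 oppr_le0 divr_ge0 ?sqr_ge0.
Qed.

Lemma noise_prob_scale sigma eps : 0 < sigma ->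
  let a := noise_scale sigma eps in
  noise_prob sigma eps * a ^+ 2 * expR (a ^+ 2 / sigma ^+ 2) = sigma ^+ 2 / 32.
Proof.
move=> s0 a; rewrite /noise_prob -/a.
have a0 : 0 < a := noise_scale_gt0 eps s0.
have := expRxMexpNx_1 (a ^+ 2 / sigma ^+ 2).
set x := expR _; set y := expR _ => xy.
have -> : (sigma / 4) ^+ 2 / (2 * a ^+ 2) * y * a ^+ 2 * x =
  (sigma ^+ 2 / 32) * (x * y) by field; rewrite gt_eqF.
by rewrite xy mulr1.
Qed.

(** The third absolute moment of the noise stays bounded even when [eps] does not: its extra factor
    [a] is at most [sigma * expR (a ^+ 2 / sigma ^+ 2)]. The null moment condition relies on
    this. *)
Lemma noise_third_moment sigma eps : 0 < sigma ->
  2 * noise_prob sigma eps * noise_scale sigma eps ^+ 3 <= 4 * (sigma / 4) ^+ 3.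
Proof.
move=> s0; have := noise_prob_scale eps s0; rewrite /=.
have a0 := noise_scale_gt0 eps s0; have q0 := noise_prob_gt0 eps s0.
set a := noise_scale _ _ in a0 *; set q := noise_prob _ _ in q0 *.
have aE : a <= sigma * expR (a ^+ 2 / sigma ^+ 2).
  have : 1 + (a / sigma) ^+ 2 <= expR (a ^+ 2 / sigma ^+ 2).
    by rewrite expr_div_n expR_ge1Dx.
  move/(ler_wpM2l (ltW s0)); apply: le_trans.
  have -> : a = sigma * (a / sigma) by field; rewrite gt_eqF.
  rewrite ler_wpM2l ?ltW//.
  have -> : sigma * (a / sigma) = a by field; rewrite gt_eqF.
  by have := sqr_ge0 (a / sigma - 1 / 2); lra.
move=> qE; apply: (@le_trans _ _ (2 * (sigma * (q * a ^+ 2 *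
    expR (a ^+ 2 / sigma ^+ 2))))).
  have := ler_wpM2l (mulr_ge0 (ltW q0) (sqr_ge0 a)) aE.
  set X := expR _; lra.
by rewrite qE expr_div_n; lra.
Qed.

Lemma noise_chi2 sigma eps : 0 < sigma -> 0 < eps ->
  1 + (eps / noise_scale sigma eps) ^+ 2 * ((noise_prob sigma eps)^-1 - 1) <=
  expR (96 / sigma ^+ 2 * eps ^+ 2).
Proof.
move=> s0 e0; set a := noise_scale sigma eps.
have a0 : 0 < a := noise_scale_gt0 eps s0.
have -> : (noise_prob sigma eps)^-1 =
  2 * (a / (sigma / 4)) ^+ 2 * expR (a ^+ 2 / sigma ^+ 2).
  rewrite /noise_prob -/a expRN; field.
  by rewrite !gt_eqF ?expR_gt0//.
pose X := (eps / (sigma / 4)) ^+ 2.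
have X0 : 0 <= X by exact: sqr_ge0.
have -> : 96 / sigma ^+ 2 * eps ^+ 2 = 6 * X.
  by rewrite /X; field; rewrite gt_eqF.
(* For large [eps] the mixing weight is 1, and the left side is [2 * X * expR (X / 16)]. For small
   [eps] the probability is constant, and the left side is at most [1 + 3 * X]. *)
have [se|es] := leP (sigma / 4) eps.
  have aeps : a = eps by rewrite /a /noise_scale max_l.
  rewrite aeps divff ?gt_eqF// expr1n mul1r -/X addrCA subrr addr0.
  have -> : eps ^+ 2 / sigma ^+ 2 = X / 16 by rewrite /X; field; rewrite gt_eqF.
  have -> : 6 * X = 2 * X + 4 * X by ring.
  rewrite expRD ler_pM ?expR_ge0//.
    by rewrite mulr_ge0.
    by have := expR_ge1Dx (2 * X); lra.
  by rewrite ler_expR; lra.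
have as4 : a = sigma / 4 by rewrite /a /noise_scale max_r// ltW.
rewrite as4 -/X divff; last by rewrite gt_eqF//; lra.
have -> : (sigma / 4) ^+ 2 / sigma ^+ 2 = 1 / 16 by field; rewrite gt_eqF.
apply: le_trans (expR_ge1Dx _); rewrite expr1n mulr1.
have : expR (1 / 16) <= 2 :> R by apply: expR_small_le; lra.
by move/(ler_wpM2l X0); lra.
Qed.

End noise.

(** * Random vectors with independent, shifted and scaled coordinates *)

Section product_law.
Context {R : realType} {d : nat}.
Context (p : 'I_d -> 'I_3 -> R) (loc scale : 'I_d -> R).

Definition location_scale (w : {ffun 'I_d -> 'I_3}) : rvec R d :=
  [tuple loc k + scale k * sign3 (w k) | k < d].

Lemma coordinateE k w :
  coordinate k (location_scale w) = loc k + scale k * sign3 (w k).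
Proof. by rewrite /coordinate tnth_mktuple. Qed.

Lemma measurable_coordinate k :
  measurable_fun [set: rvec R d] (@coordinate R d k).
Proof. exact: measurable_tnth. Qed.

Lemma measurable_contrast (P : probability (rvec R d) R) r k :
  measurable_fun [set: rvec R d] (contrast P r k).
Proof.
by apply: measurable_funB; apply: measurable_funB => //;
  exact: measurable_coordinate.
Qed.

Context (p_ge0 : forall k v, 0 <= p k v) (p_sum : forall k, \sum_v p k v = 1).
Context (P : probability (rvec R d) R).
Context (lawP : finite_law (prod_weight p) location_scale P).

Lemma product_law_has_mean : has_mean P.
Proof.
by move=> k; apply: finite_law_integrable lawP _; exact: measurable_coordinate.
Qed.

Lemma product_law_mean k :
  mean P k = loc k + scale k * \sum_v p k v * sign3 v.
Proof.
rewrite /mean (finite_law_expectation lawP); last exact: measurable_coordinate.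
rewrite /=; under eq_bigr do rewrite coordinateE.
rewrite (prod_weight_marginal _ (fun v => loc k + scale k * sign3 v))//.
rewrite (eq_bigr (fun v => loc k * p k v + scale k * (p k v * sign3 v))).
  by rewrite big_split/= -!mulr_sumr p_sum mulr1.
by move=> v _; ring.
Qed.

(** By independence the generating function along [v] factors over the coordinates, at the arguments
    [l * v k], whose squares add up to [l ^+ 2]. *)
Lemma product_law_sub_gaussian sigma :
  (forall k y, \sum_v p k v * expR (y * (scale k * sign3 v -
     scale k * \sum_u p k u * sign3 u)) <= expR (y ^+ 2 * sigma ^+ 2 / 2)) ->
  sub_gaussian sigma P.
Proof.
move=> mgf; split; first exact: product_law_has_mean.
move=> v l v1; rewrite (finite_law_expectation lawP); last first.
  apply: measurableT_comp => //; apply: measurable_funM => //.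
  apply: measurable_sum => k; apply: measurable_funM => //.
  by apply: measurable_funB => //; exact: measurable_coordinate.
rewrite lee_fin.
pose g k u := expR (l * v k * (scale k * sign3 u -
  scale k * \sum_u p k u * sign3 u)).
rewrite (eq_bigr (fun w => prod_weight p w * \prod_k g k (w k))); last first.
  move=> w _; congr (_ * _); rewrite -expR_sum mulr_sumr; congr expR.
  apply: eq_bigr => k _; rewrite coordinateE product_law_mean; ring.
rewrite sum_prod_weight.
apply: (@le_trans _ _ (\prod_k expR ((l * v k) ^+ 2 * sigma ^+ 2 / 2))).
  apply: ler_prod => k _; rewrite mgf andbT.
  by apply: sumr_ge0 => u _; rewrite mulr_ge0 ?expR_ge0.
rewrite -expR_sum ler_expR le_eqVlt; apply/orP; left; apply/eqP.
rewrite -[RHS]mulr1 -v1 mulr_sumr; apply: eq_bigr => k _; ring.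
Qed.

End product_law.

(** * The null law and the alternatives, indexed by [S] *)

Section least_favorable.
Context {R : realType} {d : nat}.
Context (r : 'I_d) (S : {set 'I_d}) (sigma eps M : R).
Context (sigma_gt0 : 0 < sigma) (eps_gt0 : 0 < eps) (M_gt0 : 0 < M).
Context (rS : r \notin S).

Local Notation a := (noise_scale sigma eps).
Local Notation q := (noise_prob sigma eps).
Local Notation t := (eps / a).

(** A large [M] keeps the indices outside [S] and [r] above the threshold of the confusion set. *)
Definition lf_loc k : R := if (k == r) || (k \in S) then 0 else M.

(** The sign at [r] keeps the variance of every contrast at least [(sigma / 4) ^+ 2], also at
    constant coordinates and when the variance on [S] vanishes for growing [eps]. *)
Definition lf_scale k : R :=
  if k == r then sigma / 4 else if k \in S then a else 0.

Definition lf_prob k : R := if k == r then 1 / 2 else q.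

Definition null_weight k : 'I_3 -> R := three_point (lf_prob k).

Definition alt_weight j : 'I_d -> 'I_3 -> R := tilt_at (tilt q t) null_weight j.

Let a_gt0 : 0 < a := noise_scale_gt0 eps sigma_gt0.
Let q_gt0 : 0 < q := noise_prob_gt0 eps sigma_gt0.
Let q_neq0 : q != 0. Proof. by rewrite gt_eqF. Qed.

(** The scale is at least [eps] precisely so that [t] is a valid mixing weight. *)
Let t_bounds : 0 <= t <= 1.
Proof.
apply/andP; split; first exact/ltW/divr_gt0.
by rewrite ler_pdivrMr// mul1r noise_scale_ge_eps.
Qed.

Lemma lf_prob_bounds k : 0 <= lf_prob k <= 1 / 2.
Proof.
rewrite /lf_prob; case: ifP => _; first by lra.
by rewrite (ltW q_gt0) noise_prob_le.
Qed.

Lemma null_weight_ge0 k v : 0 <= null_weight k v.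
Proof. exact/three_point_ge0/lf_prob_bounds. Qed.

Lemma null_weight_sum k : \sum_v null_weight k v = 1.
Proof. exact: three_point_sum. Qed.

Lemma null_weight_in k : k \in S -> null_weight k = three_point q.
Proof.
move=> kS; rewrite /null_weight /lf_prob; case: eqP => // kr.
by have := rS; rewrite -kr kS.
Qed.

Lemma alt_weight_ge0 j k v : 0 <= alt_weight j k v.
Proof.
rewrite /alt_weight /tilt_at; case: ifP => _; last exact: null_weight_ge0.
by rewrite mulr_ge0 ?null_weight_ge0 ?tilt_ge0.
Qed.

Lemma alt_weight_sum j k : j \in S -> \sum_v alt_weight j k v = 1.
Proof.
move=> jS; rewrite /alt_weight /tilt_at; case: eqP => [->|_].
  by rewrite null_weight_in// three_point_tilt_sum.
exact: null_weight_sum.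
Qed.

Lemma alt_weight_mean j k : j \in S ->
  \sum_v alt_weight j k v * sign3 v = if k == j then - t else 0.
Proof.
move=> jS; rewrite /alt_weight /tilt_at; case: eqP => [->|_].
  by rewrite null_weight_in// three_point_tilt_mean.
exact: three_point_mean.
Qed.

Lemma null_weight_mgf k y :
  \sum_v null_weight k v * expR (y * (lf_scale k * sign3 v)) <=
  expR (y ^+ 2 * sigma ^+ 2 / 2).
Proof.
have s2 : 0 < sigma ^+ 2 by rewrite exprn_gt0.
apply: three_point_mgf => //; first by case/andP: (lf_prob_bounds k).
rewrite /lf_prob /lf_scale; case: ifP => _.
  have -> : (sigma / 4) ^+ 2 / sigma ^+ 2 = 1 / 16 by field; rewrite gt_eqF.
  have e2 : expR (1 / 16) <= 2 :> R by apply: expR_small_le; lra.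
  apply: (@le_trans _ _ (1 / 2 * (sigma / 4) ^+ 2 * 2)); last by lra.
  by rewrite ler_wpM2l// mulr_ge0// sqr_ge0.
case: ifP => _; first by rewrite noise_prob_scale//; lra.
by rewrite expr0n/= mulr0 mul0r; lra.
Qed.

(** At the tilted coordinate there are two regimes. If [eps < sigma / 4], the values are bounded by
    [sigma / 4] and [bounded_mgf] applies. Otherwise the mixing weight is 1, so the coordinate is
    constant and its centered generating function is 1. *)
Lemma alt_weight_mgf j k y : j \in S ->
  \sum_v alt_weight j k v * expR (y * (lf_scale k * sign3 v -
     lf_scale k * \sum_u alt_weight j k u * sign3 u)) <=
  expR (y ^+ 2 * sigma ^+ 2 / 2).
Proof.
move=> jS; have [->{k}|kj] := eqVneq k j; last first.
  rewrite alt_weight_mean// (negbTE kj) mulr0.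
  under eq_bigr do rewrite subr0 /alt_weight /tilt_at (negbTE kj).
  exact: null_weight_mgf.
have jr : j == r = false by apply/negbTE; apply: contraNneq rS => <-.
rewrite /lf_scale jr jS.
have [se|es] := leP (sigma / 4) eps; last first.
  have -> : a = sigma / 4 by rewrite /noise_scale max_r// ltW.
  apply: le_trans (bounded_mgf _ _ _ _) _.
  - exact: alt_weight_ge0.
  - exact: alt_weight_sum.
  - rewrite ler_expR.
    rewrite exprMn expr_div_n.
    by have := mulr_ge0 (sqr_ge0 y) (sqr_ge0 sigma); lra.
have aeps : a = eps by rewrite /noise_scale max_l.
rewrite alt_weight_mean// eqxx /alt_weight /tilt_at eqxx null_weight_in//.
rewrite sum3 !sign3E /three_point /tilt/= aeps divff ?gt_eqF//.
rewrite (_ : y * _ = 0); last by ring.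
rewrite expR0 subrr add0r !addr0 !mulr0 !mul0r !addr0 mulr1 mul1r divff//.
apply: le_trans (expR_ge1Dx _).
by have := mulr_ge0 (sqr_ge0 y) (sqr_ge0 sigma); lra.
Qed.

Local Notation law p :=
  (finite_law (prod_weight p) (location_scale lf_loc lf_scale)).

Section alternative.
Context (P : probability (rvec R d) R) (j : 'I_d) (jS : j \in S).
Context (lawP : law (alt_weight j) P).

Let jr : j != r. Proof. by apply: contraNneq rS => <-. Qed.

Lemma alt_law_mean k : mean P k = if k == j then - eps else lf_loc k.
Proof.
rewrite (product_law_mean _ lawP); last by move=> i; exact: alt_weight_sum.
rewrite alt_weight_mean//; case: eqP => [->|_]; last by rewrite mulr0 addr0.
rewrite /lf_loc /lf_scale jS orbT (negbTE jr) add0r mulrN.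
by rewrite mulrCA divff ?mulr1// gt_eqF.
Qed.

Lemma alt_law_mean_r : mean P r = 0.
Proof. by rewrite alt_law_mean eq_sym (negbTE jr) /lf_loc eqxx. Qed.

Lemma lf_loc_ge0 k : 0 <= lf_loc k.
Proof. by rewrite /lf_loc; case: ifP => _ //; exact: ltW. Qed.

Lemma alt_law_mean_ge k : - eps <= mean P k.
Proof.
rewrite alt_law_mean; case: ifP => // _; apply: le_trans (lf_loc_ge0 k).
by rewrite oppr_le0 ltW.
Qed.

Lemma alt_law_min_mean : min_mean P r = - eps.
Proof.
apply/eqP; rewrite eq_le; apply/andP; split; last first.
  apply/bigmin_geP; split; first exact: alt_law_mean_ge.
  by move=> k _; exact: alt_law_mean_ge.
rewrite /min_mean (bigminD1 j)//= ge_min; apply/orP; left.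
by rewrite alt_law_mean eqxx.
Qed.

Lemma alt_law_best_but k : best_but P r k = (k == j).
Proof.
rewrite /best_but/=; apply/andP/eqP => [[kr /forall_inP/(_ j jr)]|->].
  rewrite !alt_law_mean eqxx; case: eqP => // _.
  by rewrite leNgt (lt_le_trans _ (lf_loc_ge0 k))// oppr_lt0.
split; first exact: jr.
apply/forall_inP => i _; rewrite [leLHS]alt_law_mean eqxx.
exact: alt_law_mean_ge.
Qed.

(** The confusion set is [S :\ j]: its indices have mean 0, hence gap exactly [eps], while an index
    outside [S] and [r] has gap [M + eps], beyond the upper threshold. *)
Lemma alt_law_alternative (C : R) n tau :
  #|S| = tau.+1 -> eps <= C * Num.sqrt (ln d%:R / n%:R) ->
  C * Num.sqrt (ln d%:R / n%:R) < M ->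
  alternative_class sigma C n r eps tau P.
Proof.
move=> cardS epsC CM; split.
- apply: (product_law_sub_gaussian _ _ lawP).
  + exact: alt_weight_ge0.
  + by move=> k; exact: alt_weight_sum.
  + by move=> k y; exact: alt_weight_mgf.
- by rewrite alt_law_mean_r alt_law_min_mean sub0r opprK.
- suff -> : #|confusion_set C n P r| = #|S :\ j|.
    by have := cardsD1 j S; rewrite jS cardS => -[].
  apply: eq_card => k; rewrite !inE alt_law_best_but alt_law_mean_r.
  rewrite alt_law_min_mean alt_law_mean sub0r opprK.
  have [->|kj] := eqVneq k j; first by rewrite andbF.
  rewrite /= /lf_loc; have [->|kr] := eqVneq k r; first by rewrite (negbTE rS).
  case: (boolP (k \in S)) => kS /=.
    rewrite add0r epsC andbT; apply/idP.
    by have := eps_gt0; lra.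
  apply/negbTE; rewrite negb_and -!ltNge; apply/orP; right.
  by have := eps_gt0; lra.
Qed.

End alternative.

Section null.
Context (P : probability (rvec R d) R) (lawP : law null_weight P).

Lemma null_law_mean k : mean P k = lf_loc k.
Proof.
rewrite (product_law_mean null_weight_sum lawP).
by rewrite [X in _ * X]three_point_mean mulr0 addr0.
Qed.

Lemma null_law_contrast k w :
  contrast P r k (location_scale lf_loc lf_scale w) =
  sigma / 4 * sign3 (w r) - lf_scale k * sign3 (w k).
Proof.
rewrite /contrast !coordinateE !null_law_mean {1}/lf_scale eqxx; ring.
Qed.

Lemma null_law_contrast_var k : k != r ->
  exists2 v, contrast_var P r k = v%:E & (sigma / 4) ^+ 2 <= v.
Proof.
move=> kr; rewrite /contrast_var (finite_law_expectation lawP); last first.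
  by apply: measurable_funX; exact: measurable_contrast.
eexists; first by [].
rewrite (eq_bigr (fun w =>
  (sigma / 4) ^+ 2 * (prod_weight null_weight w * sign3 (w r) ^+ 2) +
  lf_scale k ^+ 2 * (prod_weight null_weight w * sign3 (w k) ^+ 2) -
  2 * (sigma / 4) * lf_scale k *
    (prod_weight null_weight w * (sign3 (w r) * sign3 (w k))))); last first.
  by move=> w _; rewrite null_law_contrast; ring.
rewrite sumrB big_split/= -!mulr_sumr.
have rk : r != k by rewrite eq_sym.
rewrite (prod_weight_marginal2 sign3 sign3 null_weight_sum rk).
rewrite (prod_weight_marginal _ (fun v => sign3 v ^+ 2) null_weight_sum).
have -> : \sum_v null_weight r v * sign3 v = 0 by exact: three_point_mean.
rewrite mul0r mulr0 subr0.
have -> : \sum_v null_weight r v * sign3 v ^+ 2 = 1 :> R.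
  by rewrite sum3 !sign3E /null_weight /lf_prob eqxx /three_point/=; field.
rewrite mulr1 lerDl mulr_ge0 ?sqr_ge0//.
apply: sumr_ge0 => w _; rewrite mulr_ge0 ?sqr_ge0//.
by apply: prod_weight_ge0; exact: null_weight_ge0.
Qed.

Lemma null_law_null : null_distribution r P.
Proof.
split.
- exact: product_law_has_mean lawP.
- move=> k kr; have [v -> sv] := null_law_contrast_var kr.
  rewrite lte_fin ltry andbT; apply: lt_le_trans sv.
  by rewrite exprn_gt0// divr_gt0.
- apply/forallP => k; rewrite !null_law_mean {1}/lf_loc eqxx/=.
  exact: lf_loc_ge0.
Qed.

Lemma null_law_third_moment k : k != r ->
  \sum_v null_weight k v * `|lf_scale k * sign3 v| ^+ 3 <= 4 * (sigma / 4) ^+ 3.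
Proof.
move=> kr; rewrite /null_weight /lf_prob /lf_scale (negbTE kr).
have s3 : 0 <= (sigma / 4) ^+ 3 by rewrite exprn_ge0// divr_ge0// ltW.
case: ifP => _; last first.
  under eq_bigr do rewrite mul0r normr0 expr0n mulr0.
  by rewrite big1//; lra.
have := noise_third_moment eps sigma_gt0.
rewrite sum3 !sign3E /three_point/= mulr0 normr0 expr0n/= mulr0 !mulr1 mulrN1.
by rewrite normrN gtr0_norm//; lra.
Qed.

(** Bounding the minimum by its second argument leaves a normalized third absolute moment. The
    constant is [20 = 4 * (1 + 4)]: 4 from the cube of a sum, 1 from the sign at [r], and 4 from
    [noise_third_moment]. *)
Lemma null_law_truncated_moment n k : (0 < n)%N -> k != r ->
  (truncated_moment n P r k <= (20 / Num.sqrt n%:R)%:E)%E.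
Proof.
move=> n0 kr; have [v vE sv] := null_law_contrast_var kr.
rewrite /truncated_moment vE /=.
have rn0 : 0 < Num.sqrt n%:R :> R by rewrite sqrtr_gt0 ltr0n.
set s := sigma / 4 in sv *; have s0 : 0 < s by rewrite divr_gt0.
have v0 : 0 < v by apply: lt_le_trans sv; rewrite exprn_gt0.
have svv : s <= Num.sqrt v.
  by rewrite -(ger0_norm (ltW s0)) -sqrtr_sqr ler_sqrt// ltW.
rewrite (finite_law_expectation lawP); last first.
  have mW := measurable_contrast P r k.
  apply: measurable_funM.
    by apply: measurable_funM => //; exact: measurable_funX.
  apply: measurable_minr => //; apply: measurable_funM => //.
  exact: measurableT_comp.
rewrite lee_fin.
have pw w : contrast P r k (location_scale lf_loc lf_scale w) ^+ 2 / v *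
    Num.min 1 (`|contrast P r k (location_scale lf_loc lf_scale w)| /
      (Num.sqrt n%:R * Num.sqrt v)) <=
   4 * (`|s * sign3 (w r)| ^+ 3 + `|lf_scale k * sign3 (w k)| ^+ 3) /
     (s ^+ 3 * Num.sqrt n%:R).
  set W := contrast _ _ _ _.
  apply: (@le_trans _ _ (W ^+ 2 / s ^+ 2 * (`|W| / (Num.sqrt n%:R * s)))).
    apply: ler_pM.
    - by rewrite divr_ge0 ?sqr_ge0// ltW.
    - by rewrite le_min ler01/= divr_ge0// mulr_ge0// sqrtr_ge0.
    - by rewrite ler_wpM2l ?sqr_ge0// lef_pV2// posrE// exprn_gt0.
    - rewrite ge_min; apply/orP; right.
      have rv : 0 < Num.sqrt v by rewrite sqrtr_gt0.
      by rewrite ler_wpM2l// lef_pV2 ?posrE ?mulr_gt0// ler_wpM2l// ltW.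
  have -> : W ^+ 2 / s ^+ 2 * (`|W| / (Num.sqrt n%:R * s)) =
    `|W| ^+ 3 / (s ^+ 3 * Num.sqrt n%:R).
    rewrite -(real_normK (num_real W)); field.
    by rewrite !gt_eqF.
  rewrite ler_wpM2r//.
    by rewrite invr_ge0 mulr_ge0 ?exprn_ge0 ?ltW.
  have Wle : `|W| <= `|s * sign3 (w r)| + `|lf_scale k * sign3 (w k)|.
    by rewrite /W null_law_contrast ler_normB.
  apply: (@le_trans _ _ ((`|s * sign3 (w r)| +
      `|lf_scale k * sign3 (w k)|) ^+ 3)).
    by rewrite lerXn2r// nnegrE addr_ge0.
  have := normr_ge0 (s * sign3 (w r)).
  have := normr_ge0 (lf_scale k * sign3 (w k)).
  move: `|s * _| `|_ * _| => x y y0 x0.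
  (* The difference of the two sides is [3 * (x + y) * (x - y) ^+ 2]. *)
  have := mulr_ge0 (addr_ge0 x0 y0) (sqr_ge0 (x - y)); lra.
apply: (@le_trans _ _ (\sum_w prod_weight null_weight w *
  (4 * (`|s * sign3 (w r)| ^+ 3 + `|lf_scale k * sign3 (w k)| ^+ 3) /
     (s ^+ 3 * Num.sqrt n%:R)))).
  apply: ler_sum => w _; rewrite ler_wpM2l//.
  by apply: prod_weight_ge0; exact: null_weight_ge0.
set D := s ^+ 3 * Num.sqrt n%:R.
rewrite (eq_bigr (fun w =>
  4 / D * (prod_weight null_weight w * `|s * sign3 (w r)| ^+ 3) +
  4 / D * (prod_weight null_weight w * `|lf_scale k * sign3 (w k)| ^+ 3)));
  last by move=> w _; ring.
rewrite big_split/= -!mulr_sumr.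
rewrite (prod_weight_marginal _ (fun v => `|s * sign3 v| ^+ 3) null_weight_sum).
rewrite (prod_weight_marginal _ (fun v => `|lf_scale k * sign3 v| ^+ 3)
  null_weight_sum).
have -> : \sum_v null_weight r v * `|s * sign3 v| ^+ 3 = s ^+ 3.
  rewrite sum3 !sign3E /null_weight /lf_prob eqxx /three_point/=.
  rewrite mulr0 normr0 expr0n/= mulr0 !mulr1 mulrN1 normrN gtr0_norm//.
  by field.
have D0 : 0 < D by rewrite mulr_gt0// exprn_gt0.
have -> : 20 / Num.sqrt n%:R = 4 / D * s ^+ 3 + 4 / D * (4 * s ^+ 3).
  by rewrite /D; field; rewrite !gt_eqF.
rewrite lerD2l; apply: ler_wpM2l; first by rewrite divr_ge0// ltW.
exact: null_law_third_moment.
Qed.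

End null.

(** If every alternative gave [A] a larger probability, summing over [S] would contradict
    [mixture_bound]. The law [Q] depends on [A], which is enough to bound a supremum over
    alternatives for a given test. *)
Lemma least_favorable_exists (C delta : R) n tau :
  #|S| = tau.+1 -> 0 < delta ->
  expR (96 / sigma ^+ 2 * eps ^+ 2) ^+ (2 * n) - 1 <= delta ^+ 2 * tau.+1%:R ->
  eps <= C * Num.sqrt (ln d%:R / n%:R) ->
  C * Num.sqrt (ln d%:R / n%:R) < M ->
  forall P (A : set ((2 * n).-tuple (rvec R d))),
  law null_weight P -> measurable A ->
  exists2 Q, alternative_class sigma C n r eps tau Q &
    (iid_law Q (2 * n) A <= iid_law P (2 * n) A + delta%:E)%E.
Proof.
move=> cardS d0 BS epsC CM P A lawP mA.
apply: contrapT => /forall2NP noQ.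
set x := location_scale lf_loc lf_scale in lawP *.
pose phi (z : (2 * n).-tuple _) : R := \1_A (map_tuple x z).
have : \sum_(j in S) iid_sum (prod_weight (alt_weight j)) phi <=
   #|S|%:R * (iid_sum (prod_weight null_weight) phi + delta).
  rewrite (eq_bigr (fun j => iid_sum (fun w =>
    prod_weight null_weight w * tilt q t (w j)) phi)); last first.
    move=> j _; suff -> : prod_weight (alt_weight j) = fun w =>
      prod_weight null_weight w * tilt q t (w j) by [].
    by apply/funext => w; exact: prod_weight_tilt_at.
  apply: (@mixture_bound R _ _ (prod_weight null_weight) S
    (fun j w => tilt q t (w j))
    (expR (96 / sigma ^+ 2 * eps ^+ 2)) delta _ phi) => //.
  - by move=> w; apply: prod_weight_ge0; exact: null_weight_ge0.
  - exact/sum_prod_weight1/null_weight_sum.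
  - by rewrite cardS.
  - by move=> z; rewrite /phi indicE; case: (_ \in _); rewrite ?ler01 ?lexx.
  - move=> j jS; rewrite prod_weight_marginal//; last exact: null_weight_sum.
    by rewrite null_weight_in// three_point_tilt_sum.
  - move=> j jS.
    rewrite (prod_weight_marginal _ (fun v => tilt q t v * tilt q t v));
      last exact: null_weight_sum.
    by rewrite null_weight_in// three_point_tilt_sqr// noise_chi2.
  - move=> j k jS kS jk.
    rewrite prod_weight_marginal2//; last exact: null_weight_sum.
    by rewrite !null_weight_in// three_point_tilt_sum// mulr1.
  - by rewrite cardS.
apply/negP; rewrite -ltNge mulr_natl -sumr_const.
apply: ltr_sum.
  have /card_gt0P[j jS] : (0 < #|S|)%N by rewrite cardS.
  by apply/hasP; exists j => //; exact: mem_index_enum.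
move=> j jS.
have [Q lawQ] : exists Q : probability (rvec R d) R,
    law (alt_weight j) Q.
  apply: finite_law_exists.
    by move=> w; apply: prod_weight_ge0; exact: alt_weight_ge0.
  by apply: sum_prod_weight1 => k; exact: alt_weight_sum.
have [/(_ (alt_law_alternative jS lawQ cardS epsC CM))//|] := noQ Q.
move/negP; rewrite -ltNge.
by rewrite (iid_law_finite lawP)// (iid_law_finite lawQ)// -EFinD lte_fin.
Qed.

End least_favorable.

(** * Numerical estimates at the critical radius *)

(** Tangent bounds at [b * L] for the values at [L] and at 0, averaged with weights [b] and [1 - b];
    the linear terms cancel. *)
Lemma expR_convex (R : realType) (b L : R) : 0 <= b <= 1 ->
  expR (b * L) - 1 <= b * (expR L - 1).
Proof.
move=> /andP[b0 b1].
have H0 : expR (b * L) * (1 + (1 - b) * L) <= expR L.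
  rewrite [in leRHS](_ : L = b * L + (1 - b) * L); last by ring.
  by rewrite expRD ler_wpM2l ?expR_ge0 ?expR_ge1Dx.
have H1 : expR (b * L) * (1 + - (b * L)) <= 1.
  rewrite -[leRHS](expRxMexpNx_1 (b * L)).
  by rewrite ler_wpM2l ?expR_ge0 ?expR_ge1Dx.
have := ler_wpM2l b0 H0.
have b1' : 0 <= 1 - b by rewrite subr_ge0.
have := ler_wpM2l b1' H1; lra.
Qed.

Lemma expR1_le4 (R : realType) : expR 1 <= 4 :> R.
Proof.
have -> : 1 = 2%:R * (1 / 2) :> R by field.
rewrite expRM_natl; set x := expR _.
have : x * expR (- (1 / 2)) = 1 by exact: expRxMexpNx_1.
have := expR_ge1Dx (- (1 / 2) : R); have := expR_gt0 (1 / 2 : R); rewrite -/x.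
move: (expR _) => y x0 y0 xy.
have x2 : x <= 2 by nra.
by have := ler_pM (ltW x0) (ltW x0) x2 x2; rewrite expr2; lra.
Qed.

(** With [L = 1 \/ ln tau], the exponent is at most [b * L], where
    [b = 2 * 96 / 30 ^+ 2 * delta ^+ 2]. By convexity only the factor [b] multiplies
    [expR L - 1 <= 3 + tau], and [3 * b <= delta ^+ 2]. *)
Lemma chi2_critical_radius (R : realType) (sigma delta eps : R) n tau :
  0 < sigma -> 0 < delta <= 1 -> 0 < eps -> (0 < n)%N ->
  eps <= delta * sigma / 30 * critical_radius n tau ->
  expR (96 / sigma ^+ 2 * eps ^+ 2) ^+ (2 * n) - 1 <= delta ^+ 2 * tau.+1%:R.
Proof.
move=> s0 /andP[d0 d1] e0 n0; rewrite /critical_radius.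
set L := Num.max _ _ => epsL.
have n0R : 0 < n%:R :> R by rewrite ltr0n.
have L1 : 1 <= L by rewrite le_max lexx.
have LT : expR L <= 4 + tau%:R.
  rewrite /L /Num.max; case: ifPn => ltau.
    have tau0 : (0 < tau)%N.
      (* As [ln 0] is 0 by convention, [1 < ln tau] excludes [tau = 0]. *)
      by rewrite lt0n; apply: contraTneq ltau => ->; rewrite ln0// -leNgt.
    by rewrite lnK ?posrE ?ltr0n//; lra.
  by have := expR1_le4 R; have := ler0n R tau; lra.
have e2 : eps ^+ 2 <= (delta * sigma / 30) ^+ 2 * (L / n%:R).
  have Ln : 0 <= L / n%:R by apply: divr_ge0; lra.
  rewrite -[X in _ * X]sqr_sqrtr// -exprMn lerXn2r// ?nnegrE ?ltW//.
  exact: lt_le_trans epsL.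
pose b := 192 / 900 * delta ^+ 2.
have b01 : 0 <= b <= 1.
  have : delta ^+ 2 <= 1 by rewrite expr_le1// ltW.
  by have := sqr_ge0 delta; rewrite /b; lra.
apply: (@le_trans _ _ (b * (expR L - 1))).
  apply: le_trans (expR_convex _ b01); rewrite lerD2r -expRM_natl ler_expR.
  have k0 : 0 <= (2 * n)%:R * (96 / sigma ^+ 2) :> R.
    by rewrite mulr_ge0// divr_ge0// sqr_ge0.
  rewrite mulrA; apply: le_trans (ler_wpM2l k0 e2) _.
  rewrite natrM le_eqVlt; apply/orP; left; apply/eqP; rewrite /b; field.
  by rewrite !gt_eqF.
have d2 := sqr_ge0 delta.
apply: (@le_trans _ _ (b * (3 + tau%:R))).
  by apply: ler_wpM2l; [case/andP: b01|lra].
have := mulr_ge0 d2 (ler0n R tau).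
by rewrite -natr1 /b; lra.
Qed.

(** Since [d >= 2], [ln d >= ln 2 >= 1 / 4], so [4 * ln d] dominates both 1 and [ln tau]; the factor
    2 is the square root of 4. *)
Lemma critical_radius_le (R : realType) n tau d : (2 <= d)%N -> (tau <= d)%N ->
  critical_radius n tau <= 2 * Num.sqrt (ln d%:R / n%:R) :> R.
Proof.
move=> d2 taud; rewrite /critical_radius.
have ln14 : 1 / 4 <= ln 2 :> R.
  by rewrite -[leLHS]expRK ler_ln ?posrE ?expR_gt0// expR_small_le//; lra.
have ln2d : ln 2 <= ln d%:R :> R.
  by rewrite ler_ln ?posrE ?ltr0n ?ler_nat// (leq_trans _ d2).
have lntau : ln tau%:R <= ln d%:R :> R.
  have [->|tau0] := posnP tau; first by rewrite ln0//; lra.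
  by rewrite ler_ln ?posrE ?ltr0n ?ler_nat// (leq_trans _ d2).
have -> : 2 = Num.sqrt (2 ^+ 2) :> R by rewrite sqrtr_sqr ger0_norm.
rewrite -sqrtrM ?sqr_ge0// ler_wsqrtr// mulrA ler_wpM2r ?invr_ge0//.
by rewrite ge_max; lra.
Qed.

(** * Subsets of given cardinality, and limits *)

Lemma exists_subset_card (T : finType) (A : {set T}) k : (k <= #|A|)%N ->
  exists2 B : {set T}, B \subset A & #|B| = k.
Proof.
move=> kA; exists [set x in take k (enum A)]%SET.
  by apply/fintype.subsetP => x; rewrite inE => /mem_take; rewrite mem_enum.
rewrite cardsE (card_uniqP _) ?take_uniq ?enum_uniq// size_take_min -cardE.
exact/minn_idPl.
Qed.

Lemma le_limn_einf (R : realType) (u v : nat -> \bar R) :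
  (\forall n \near \oo, (u n <= v n)%E) -> (limn_einf u <= limn_einf v)%E.
Proof.
move=> [N _ uv]; rewrite !limn_einf_lim; apply: lee_lim.
- exact: is_cvg_einfs.
- exact: is_cvg_einfs.
exists N => // n Nn; apply: le_ereal_inf_tmp => _ [m /= nm <-].
apply: (@le_trans _ _ (u m)); last exact: uv (leq_trans Nn nm).
by apply: ereal_inf_lbound; exists m.
Qed.

Lemma cvg_inv_sqrt (R : realType) (b : R) : 0 < b ->
  (b / Num.sqrt n%:R)%:E @[n --> \oo] --> 0%E.
Proof.
move=> b0; apply: cvg_EFin; first exact: nearW.
have sn0 : \forall n \near \oo, 0 < Num.sqrt n%:R / b :> R.
  by exists 1%N => // n /= n0; rewrite divr_gt0// sqrtr_gt0 ltr0n.
have : Num.sqrt n%:R / b @[n --> \oo] --> +oo.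
  apply/cvgryPge => A.
  have [N _ AN] := (cvgryPge _).1 (@cvgr_idn R) ((A * b) ^+ 2).
  exists N => // n Nn /=; rewrite ler_pdivlMr//.
  by rewrite (le_trans (ler_norm _))// -sqrtr_sqr ler_wsqrtr// AN.
move/(gtr0_cvgV0 sn0); apply: cvg_trans.
rewrite (_ : unstable.inv_fun _ = fun n => b / Num.sqrt n%:R)//.
by apply/funext => n /=; rewrite invf_div.
Qed.

Theorem theorem3p3 (R : realType) (alpha beta sigma : R)
    (halpha : 0 < alpha < 1 / 2) (hbeta : 0 < beta < 1 - 2 * alpha)
    (hsigma : 0 < sigma) :
  exists2 c : R, 0 < c &
  forall (d : nat -> nat) (r : forall n, 'I_(d n)) (C : nat -> R)
    (tau : nat -> nat) (eps : nat -> R),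
  (forall n, (2 <= d n)%N) ->
  (forall n, 0 < C n) -> C n @[n --> \oo] --> +oo ->
  (forall n, (tau n <= d n - 2)%N) ->
  (forall n, 0 < eps n) ->
  (forall n, (0 < n)%N -> eps n <= c * critical_radius n (tau n)) ->
  (beta%:E <=
   ereal_inf
     [set limn_einf (fun n =>
        ereal_sup [set type2_error psi P |
          P in alternative_class sigma (C n) n (r n) (eps n) (tau n)])
     | psi in asymptotic_level r alpha])%E.
Proof.
(* The slack between level and target power: an alternative whose rejection probability exceeds the
   null one by at most [delta] has type II error at least [1 - alpha - delta = beta], up to the
   limit. *)
pose delta := 1 - alpha - beta.
have d0 : 0 < delta by rewrite /delta; lra.
have d1 : delta <= 1 by rewrite /delta; lra.
pose c := delta * sigma / 30; have c0 : 0 < c by rewrite divr_gt0// mulr_gt0.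
exists c => // d r C tau eps d2 C0 Coo taud eps0 epsc.
apply: le_ereal_inf_tmp => _ [psi psiA <-].
(* Room for [tau + 1] indices other than [r] comes from [tau <= d - 2]. *)
have exS n : exists S : {set 'I_(d n)}, r n \notin S /\ #|S| = (tau n).+1.
  have [|S Sr cardS] := @exists_subset_card _ [set~ r n]%SET (tau n).+1.
    rewrite cardsC1 card_ord; move: (d2 n) (taud n).
    by case: (d n) => [|[|m]]//= _; rewrite subn2.
  exists S; split => //; apply/negP => /(fintype.subsetP Sr).
  by rewrite !inE eqxx.
pose S n := sval (cid (exS n)).
have SP n : r n \notin S n /\ #|S n| = (tau n).+1 := svalP (cid (exS n)).
(* Adding 1 puts [M] strictly above the confusion threshold. *)
pose M n := C n * Num.sqrt (ln (d n)%:R / n%:R) + 1.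
have M0 n : 0 < M n by rewrite ltr_wpDl// mulr_ge0 ?sqrtr_ge0// ltW.
have exP n : exists P : probability (rvec R (d n)) R,
    finite_law (prod_weight (null_weight (r n) sigma (eps n)))
    (location_scale (lf_loc (r n) (S n) (M n))
      (lf_scale (r n) (S n) sigma (eps n))) P.
  apply: finite_law_exists.
    by move=> w; apply: prod_weight_ge0; exact: null_weight_ge0.
  exact/sum_prod_weight1/null_weight_sum.
pose P0 n := sval (cid (exP n)); have lawP0 n := svalP (cid (exP n)).
rewrite -/(P0 _) in lawP0.
(* One null law for each [n] already forms a collection with the required moment condition, so the
   level constraint on [psi] can be applied to it. *)
have nullP0 : null_collection r (fun n => [set P0 n]).
  split => [n _ ->|].
    exact: (null_law_null hsigma (M0 n) (lawP0 n)).
  apply: (@squeeze_cvge _ _ _ _ (cst 0%E) _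
    (fun n => (20 / Num.sqrt n%:R)%:E)); last 2 first.
  - exact: cvg_cst.
  - exact: cvg_inv_sqrt.
  exists 1%N => // n /= n0; apply/andP; split.
    exact: bigmax_ge_id.
  apply/bigmax_leP; split; first by rewrite lee_fin divr_ge0// sqrtr_ge0.
  move=> k kr; rewrite image_set1 ereal_sup1.
  exact: (null_law_truncated_moment hsigma (lawP0 n)).
have level := psiA _ nullP0.
pose T1 n := type1_error psi (P0 n).
have {}level : (limn_esup T1 <= alpha%:E)%E.
  by under [T1]eq_fun do rewrite -[type1_error _ _]ereal_sup1 -image_set1.
(* The lower limit of [alpha + beta - T1 n] is at least [beta], so it remains to compare this
   sequence with the worst type II error for large [n]. *)
have -> : beta%:E = ((alpha + beta)%:E - alpha%:E)%E.
  by rewrite -EFinB; congr (_%:E); ring.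
apply: (@le_trans _ _ ((alpha + beta)%:E + limn_einf (-%E \o T1))%E).
  by rewrite limn_einfN leeD2l// leeN2.
rewrite -limn_einf_shift//; apply: le_limn_einf.
have [N _ CN] : \forall n \near \oo, 2 * c <= C n.
  by move/cvgryPge : Coo; exact.
(* The bound on [eps] is assumed for [n > 0] only, and [2 * c <= C n] brings [eps] below the
   confusion threshold. *)
exists (maxn 1 N) => // n /=; rewrite geq_max => /andP[n0 Nn].
have [rS cardS] := SP n.
have mA (b : bool) : measurable [set x | psi n x = b].
  rewrite (_ : [set x | _] = psi n @^-1` [set b])//.
  by rewrite -[X in measurable X]setTI; exact: measurable_funP.
have epsC : eps n <= C n * Num.sqrt (ln (d n)%:R / n%:R).
  apply: le_trans (epsc _ n0) _.
  have := critical_radius_le R n (d2 n) (leq_trans (taud n) (leq_subr _ _)).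
  move/(ler_wpM2l (ltW c0))/le_trans; apply.
  by rewrite mulrA [c * 2]mulrC ler_wpM2r ?sqrtr_ge0 ?CN.
have CM : C n * Num.sqrt (ln (d n)%:R / n%:R) < M n by rewrite ltrDl.
have chi2 : expR (96 / sigma ^+ 2 * eps n ^+ 2) ^+ (2 * n) - 1 <=
    delta ^+ 2 * (tau n).+1%:R.
  by apply: chi2_critical_radius => //; [rewrite d0|exact: epsc].
have [Q Qalt QP] := least_favorable_exists hsigma (eps0 n) (M0 n) rS cardS d0
  chi2 epsC CM (lawP0 n) (mA true).
apply: le_ereal_sup_tmp; exists (type2_error psi Q); first by exists Q.
have -> : type2_error psi Q = (1 - type1_error psi Q)%E.
  rewrite /type2_error /type1_error -probability_setC//; congr (iid_law _ _ _).
  by apply/seteqP; split => x /=; case: (psi n x).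
have fin (Q' : probability (rvec R (d n)) R) :
    type1_error psi Q' \is a fin_num by exact: fin_num_measure.
move: QP; rewrite -[iid_law Q _ _]/(type1_error psi Q).
rewrite -[iid_law (P0 n) _ _]/(type1_error psi (P0 n)) /comp /T1.
rewrite -(fineK (fin Q)) -(fineK (fin (P0 n))) -EFinD -!EFinB !lee_fin.
by rewrite /delta; lra.
Qed.
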